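(* For every integer $m\ge1$, $$\operatorname{pal}_{\overrightarrow C_3}(m)=\frac{m(m^2-1)}{3}.$$ Equivalently, if $\mathcal P=(\mathcal C,\mathcal A)$ is an $m$-color palette such that $\mathcal P_L\not\preceq\mathcal P$ and $\mathcal P_R\not\preceq\mathcal P$, then $d(\mathcal P)\le\frac13-\frac1{3m^2}$, and this bound is best possible (for every $m\ge 1$ it is attained by some such palette).
   Context: A palette is a pair $\mathcal P=(\mathcal C,\mathcal A)$ where $\mathcal C=\mathcal C(\mathcal P)$ is a finite set of colors and $\mathcal A=\mathcal A(\mathcal P)\subseteq\mathcal C^3$ (repeated colors allowed); it is an $m$-color palette if $|\mathcal C|=m$, and its density is $d(\mathcal P)=|\mathcal A|/|\mathcal C|^3$. A homomorphism $\mathcal P\to\mathcal P'$ is a map $f:\mathcal C(\mathcal P)\to\mathcal C(\mathcal P')$ such that $(a,b,c)\in\mathcal A(\mathcal P)$ implies $(f(a),f(b),f(c))\in\mathcal A(\mathcal P')$; write $\mathcal P\preceq\mathcal P'$ if one exists, and $\mathcal P\not\preceq\mathcal P'$ otherwise. Let $\overrightarrow C_3$ be the directed triangle, with vertex set $V$ and arc set $A$, and let $\mathcal C_0=V\sqcup\{c_{uv}:uv\in A\}$ with $c_{uv}$ new distinct colors (so $|\mathcal C_0|=6$). Put $\mathcal P_L=(\mathcal C_0,\{(u,v,c_{uv}):uv\in A\})$ and $\mathcal P_R=(\mathcal C_0,\{(c_{uv},u,v):uv\in A\})$. Finally $$\operatorname{pal}_{\overrightarrow C_3}(m)=\max\{|\mathcal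 A(\mathcal P)| : |\mathcal C(\mathcal P)|=m,\ \mathcal P_L\not\preceq\mathcal P,\ \mathcal P_R\not\preceq\mathcal P\}.$$ *)

(* Defs.v *)
From mathcomp Require Import all_boot all_order all_algebra.

Set Implicit Arguments.
Unset Strict Implicit.
Unset Printing Implicit Defensive.

Record palette := Palette {
  color : finType;
  admissible : {set color * color * color}
}.

Definition density (P : palette) : rat :=
  (#|admissible P|%:R / #|color P|%:R ^+ 3)%R.

Definition is_hom (P Q : palette) (f : color P -> color Q) : bool :=
  [forall a, forall b, forall c,
    ((a, b, c) \in admissible P) ==> ((f a, f b, f c) \in admissible Q)].

Definition hom_to (P Q : palette) : bool :=
  [exists f : {ffun color P -> color Q}, is_hom f].

Record digraph := Digraph {
  vertex : finType;
  arcs : {set vertex * vertex}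
}.

Definition arc (D : digraph) : finType := {e : vertex D * vertex D | e \in arcs D}.

(* The color [c_uv] of an arc [e = uv] is [inr e]. *)
Definition palL (D : digraph) : palette :=
  @Palette (vertex D + arc D)%type
    [set (inl (val e).1, inl (val e).2, inr e) | e : arc D].

Definition palR (D : digraph) : palette :=
  @Palette (vertex D + arc D)%type
    [set (inr e, inl (val e).1, inl (val e).2) | e : arc D].

Definition avoids (D : digraph) (P : palette) : bool :=
  ~~ hom_to (palL D) P && ~~ hom_to (palR D) P.

(* Colors can be renamed, so it suffices to range over the palettes on ['I_m].
   The range is nonempty whenever [D] has an arc (take the empty palette), so the
   convention that an empty [\max] is 0 plays no role there. *)
Definition pal (D : digraph) (m : nat) : nat :=
  \max_(A : {set 'I_m * 'I_m * 'I_m} | avoids D (Palette A)) #|A|.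

(* The arcs are 0 -> 1 -> 2 -> 0, since [ordS] is the cyclic successor. *)
Definition C3 : digraph := @Digraph 'I_3 [set (i, ordS i) | i : 'I_3].

(* Main.v *)
Require Import Defs.
From mathcomp Require Import all_boot all_order all_algebra.
From mathcomp Require Import zify ring lra.

Set Implicit Arguments.
Unset Strict Implicit.
Unset Printing Implicit Defensive.

(** A palette avoids [palL C3] and [palR C3] iff neither the digraph [L] of the
    pairs [ab] extending to some [(a, b, x)] nor the digraph [R] of the pairs
    [bc] extending to some [(x, b, c)] has a closed walk of length 3, and it has
    at most the sum over [b] of [d^-_L(b) * d^+_R(b)] triples. By AM-GM and
    reversal it suffices to bound the sum of the squared in-degrees of a digraph
    without closed 3-walks. Such a digraph has at most [s^2 / 2] arcs on [s]
    vertices (delete a 2-cycle and induct), so the in-degrees in a set of size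
    [s] sum to at most [s m - s^2 / 2]. Taking for the set the vertices of
    in-degree above [t] bounds the sum over [b] of [(d(b) - t)^+] by
    [(m - t)^2 / 2], and [d^2] is the sum of [(d - t)^+ + (d - t - 1)^+] over [t].
    Equality holds for the transitive blow-up with 2-cycles as blocks. *)

(** * Squared in-degrees of digraphs without closed 3-walks *)

Definition C3_free (T : finType) (E : rel T) :=
  forall a b c, E a b -> E b c -> E c a -> False.

Definition indeg (T : finType) (E : rel T) (b : T) : nat := \sum_a E a b.

Section InDegrees.

Variables (T : finType) (E : rel T).
Hypothesis Efree : C3_free E.

Let mult a b : nat := E a b + E b a.

Lemma C3_free_irr a : E a a = false.
Proof. by apply/negP => Eaa; apply: (@Efree a a a). Qed.

Lemma arcs_le (S : {set T}) :
  2 * (\sum_(a in S) \sum_(b in S) E a b) <= #|S| ^ 2.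
Proof.
(* Twice the number of arcs is the sum of [mult] over ordered pairs. If [S] contains no 2-cycle,
   every term is at most 1. *)
have ->: 2 * (\sum_(a in S) \sum_(b in S) E a b)
    = \sum_(a in S) \sum_(b in S) mult a b.
  rewrite mul2n -addnn {2}exchange_big -big_split /=.
  by apply: eq_bigr => a _; rewrite -big_split.
have [n leSn] := ubnP #|S|; elim: n => // n IHn in S leSn *.
case: (boolP [exists u in S, [exists v in S, E u v && E v u]]); last first.
  move=> no2; rewrite expnS expn1 -!sum_nat_const leq_sum // => a aS.
  rewrite -[#|S|]muln1 -sum_nat_const leq_sum // => b bS.
  move: no2 => /exists_inPn /(_ a aS) /exists_inPn /(_ b bS).
  by rewrite /mult; case: (E a b); case: (E b a).
case/exists_inP => u uS /exists_inP [v vS /andP[Euv Evu]].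
have neq_vu : v != u by apply: contraTneq Euv => ->; rewrite C3_free_irr.
set S' := S :\ u :\ v.
have vSu : v \in S :\ u by rewrite !inE neq_vu.
have cardS : #|S| = #|S'|.+2 by rewrite (cardsD1 u S) uS (cardsD1 v (S :\ u)) vSu.
have splitS (F : T -> nat) : \sum_(a in S) F a = F u + F v + \sum_(a in S') F a.
  by rewrite (big_setD1 u uS) (big_setD1 v vSu) /= addnA.
have multC a b : mult a b = mult b a by rewrite /mult addnC.
have mult_uv : mult u v = 2 by rewrite /mult Euv Evu.
(* With the 2-cycle on [u] and [v], an arc [a -> u] excludes [v -> a], and [a -> v] excludes
   [u -> a]; so at most two of the four possible arcs occur. *)
have mult_out a : mult u a + mult v a <= 2.
  have := @Efree a u v; have := @Efree a v u; rewrite /mult Euv Evu.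
  by case: (E a u); case: (E u a); case: (E v a); case: (E a v) => //= h1 h2;
    solve [by case: h1 | by case: h2].
have ltS' : #|S'| < n by rewrite -ltnS (leq_trans _ leSn) // cardS.
have {IHn ltS'} IH := IHn S' ltS'.
have mult0 a : mult a a = 0 by rewrite /mult C3_free_irr.
rewrite splitS !splitS (multC v u) mult_uv !mult0.
under [X in _ + X <= _]eq_bigr => a _ do rewrite splitS.
have -> : \sum_(a in S') (mult a u + mult a v + \sum_(b in S') mult a b)
    = \sum_(a in S') (mult u a + mult v a) + \sum_(a in S') \sum_(b in S') mult a b.
  by rewrite -big_split; apply: eq_bigr => a _; rewrite (multC a u) (multC a v).
have : \sum_(a in S') (mult u a + mult v a) <= #|S'| * 2.
  by rewrite -sum_nat_const leq_sum.
rewrite big_split cardS /=; move: IH.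
lia.
Qed.

Lemma indeg_excess_le t : t <= #|T| ->
  2 * (\sum_b (indeg E b - t)) <= (#|T| - t) ^ 2.
Proof.
move=> le_tm; pose S := [set b | t < indeg E b].
have -> : \sum_b (indeg E b - t) = \sum_(b in S) (indeg E b - t).
  rewrite [LHS](bigID (mem S)) /= [X in _ + X]big1 ?addn0 // => b.
  by rewrite inE -leqNgt => /eqP.
have eq_sum : \sum_(b in S) (indeg E b - t) + #|S| * t = \sum_(b in S) indeg E b.
  rewrite -sum_nat_const -big_split /=; apply: eq_bigr => b.
  by rewrite inE => /ltnW/subnK.
(* Each vertex of [S] receives at most one arc from each vertex outside [S]. *)
have le_sum : \sum_(b in S) indeg E b
    <= \sum_(a in S) \sum_(b in S) E a b + #|S| * #|~: S|.
  rewrite [X in _ <= X + _]exchange_big -sum_nat_const -big_split /=.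
  apply: leq_sum => b _; rewrite /indeg (bigID (mem S)) /= leq_add2l.
  rewrite -sum1_card (eq_bigl (mem (~: S))) => [|a]; last by rewrite !inE.
  by apply: leq_sum => a _; case: (E a b).
have := arcs_le S; have := cardsC S.
move: eq_sum le_sum le_tm; move: (\sum_(b in S) (_ - _)) (\sum_(b in S) indeg E b).
move: (\sum_(a in S) _) #|S| #|~: S| #|T| => e s r m x d eq_x le_d le_tm eq_m le_e.
(* The facts combine to [2x <= 2s(m - t) - s^2], which is at most [(m - t)^2] whatever the size
   [s]. *)
have AGM : 2 * (s * (m - t)) <= s ^ 2 + (m - t) ^ 2 by apply: nat_Cauchy.
have := congr1 (muln s) eq_m.
have : s * (m - t) + s * t = s * m by rewrite -mulnDr subnK.
move: (m - t) AGM => k; lia.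
Qed.

(** The terms are the odd numbers [2d - 1], ..., 3, 1, followed by zeros because subtraction is
    truncated. *)
Lemma sqr_excess n d : d <= n -> d ^ 2 = \sum_(t < n) ((d - t) + (d - t.+1)).
Proof.
elim: n d => [|n IHn] d le_dn; first by rewrite big_ord0; case: d le_dn.
rewrite big_ord_recl /= subn0.
rewrite (eq_bigr (fun t : 'I_n => (d.-1 - t) + (d.-1 - t.+1))); last first.
  by move=> t _; rewrite /bump /=; lia.
rewrite -IHn; last by lia.
by case: d {le_dn} => [|d] //=; lia.
Qed.

Lemma sum_pronic n : 3 * (\sum_(t < n) (n - t) * (n - t.+1)) + n = n ^ 3.
Proof.
elim: n => [|n IHn]; first by rewrite big_ord0.
rewrite big_ord_recl /= subn0 subSS subn0.
under eq_bigr => t _ do rewrite /bump /= add1n !subSS.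
move: (\sum_(t < n) _) IHn => x; lia.
Qed.

Lemma sum_sqr_indeg_le : 3 * (\sum_b indeg E b ^ 2) + #|T| <= #|T| ^ 3.
Proof.
rewrite -sum_pronic leq_add2r leq_mul2l /=.
under eq_bigr => b _.
  rewrite (@sqr_excess #|T|); last first.
    by rewrite -sum1_card leq_sum // => a _; case: (E a b).
  over.
rewrite exchange_big leq_sum //= => t _; rewrite big_split /=.
have lt_tm := ltn_ord t.
have := indeg_excess_le lt_tm; have := indeg_excess_le (ltnW lt_tm).
(* The two excess bounds add up to [k^2 + k + 1/2]; integrality removes the half and leaves the
   pronic number [k(k + 1)], which makes the final bound exact. *)
rewrite -[#|T| - t](subnSK lt_tm); move: (#|T| - t.+1) => k; lia.
Qed.

End InDegrees.

(** * Avoidance of [palL C3] and [palR C3] in terms of digraphs *)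

Lemma hom_palLP (D : digraph) (P : palette) :
  reflect (exists f : vertex D -> color P, forall e, e \in arcs D ->
             exists x, (f e.1, f e.2, x) \in admissible P)
          (hom_to (palL D) P).
Proof.
apply: (iffP existsP) => [[g /forallP homg]|[f fP]].
  exists (fun v => g (inl v)) => e eD.
  exists (g (inr (exist _ e eD))).
  move/forallP/(_ (inl e.2))/forallP/(_ (inr (exist _ e eD)))/implyP: (homg (inl e.1)).
  by apply; apply/imsetP; exists (exist _ e eD).
(* The color of an arc lies in a single triple, so its image can be chosen separately for each
   arc. *)
have gP (e : Defs.arc D) : exists x, (f (val e).1, f (val e).2, x) \in admissible P.
  exact: fP (valP e).
exists [ffun c => match c with inl v => f v | inr e => xchoose (gP e) end].
apply/forallP => a; apply/forallP => b; apply/forallP => c; apply/implyP.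
by case/imsetP => e _ [-> -> ->]; rewrite !ffunE; apply: xchooseP (gP e).
Qed.

Lemma hom_palRP (D : digraph) (P : palette) :
  reflect (exists f : vertex D -> color P, forall e, e \in arcs D ->
             exists x, (x, f e.1, f e.2) \in admissible P)
          (hom_to (palR D) P).
Proof.
apply: (iffP existsP) => [[g /forallP homg]|[f fP]].
  exists (fun v => g (inl v)) => e eD.
  exists (g (inr (exist _ e eD))).
  move/forallP/(_ (inl e.1))/forallP/(_ (inl e.2))/implyP:
    (homg (inr (exist _ e eD))).
  by apply; apply/imsetP; exists (exist _ e eD).
have gP (e : Defs.arc D) : exists x, (x, f (val e).1, f (val e).2) \in admissible P.
  exact: fP (valP e).
exists [ffun c => match c with inl v => f v | inr e => xchoose (gP e) end].
apply/forallP => a; apply/forallP => b; apply/forallP => c; apply/implyP.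
by case/imsetP => e _ [-> -> ->]; rewrite !ffunE; apply: xchooseP (gP e).
Qed.

Lemma C3_hom_freeP (T : finType) (E : rel T) :
  C3_free E <-> ~ exists f : vertex C3 -> T,
                    forall e, e \in arcs C3 -> E (f e.1) (f e.2).
Proof.
split=> [Efree [f fP]|nof a b c Eab Ebc Eca].
  have fS (i : 'I_3) : E (f i) (f (ordS i)).
    by apply: (fP (i, ordS i)); apply/imsetP; exists i.
  apply: (Efree (f ord0) (f (ordS ord0)) (f (ordS (ordS ord0)))) => //.
  have {2}-> : (ord0 : 'I_3) = ordS (ordS (ordS ord0)) by apply: val_inj.
  exact: fS.
apply: nof; exists (fun i : 'I_3 => nth a [:: a; b; c] i) => e.
by case/imsetP => -[[|[|[|i]]] lt_i3] _ -> //=.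
Qed.

Lemma palL_C3_freeP (P : palette) :
  ~~ hom_to (palL C3) P <->
  C3_free (fun a b => [exists x, (a, b, x) \in admissible P]).
Proof.
rewrite C3_hom_freeP; split=> [/hom_palLP nof [f fP]|nof].
  by apply: nof; exists f => e /fP/existsP.
by apply/hom_palLP => -[f fP]; apply: nof; exists f => e /fP ?; apply/existsP.
Qed.

Lemma palR_C3_freeP (P : palette) :
  ~~ hom_to (palR C3) P <->
  C3_free (fun b c => [exists x, (x, b, c) \in admissible P]).
Proof.
rewrite C3_hom_freeP; split=> [/hom_palRP nof [f fP]|nof].
  by apply: nof; exists f => e /fP/existsP.
by apply/hom_palRP => -[f fP]; apply: nof; exists f => e /fP ?; apply/existsP.
Qed.

(** * The upper bound on the number of triples *)

Lemma card_cherries (T : finType) (L R : rel T) :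
  #|[set p : T * T * T | L p.1.1 p.1.2 && R p.2 p.1.2]|
    = \sum_b indeg L b * indeg R b.
Proof.
rewrite -sum1_card big_mkcond /=.
rewrite (eq_bigr (fun p => L p.1.1 p.1.2 * R p.2 p.1.2)); last first.
  by move=> p _; rewrite inE mulnb; case: (_ && _).
rewrite -(pair_bigA _ (fun q c => L q.1 q.2 * R c q.2)) /=.
rewrite -(pair_bigA _ (fun a b => \sum_c L a b * R c b)) /=.
rewrite exchange_big; apply: eq_bigr => b _.
by rewrite /indeg big_distrl; apply: eq_bigr => a _; rewrite big_distrr.
Qed.

Lemma card_admissible_le (P : palette) :
  ~~ hom_to (palL C3) P -> ~~ hom_to (palR C3) P ->
  3 * #|admissible P| + #|color P| <= #|color P| ^ 3.
Proof.
move=> /palL_C3_freeP; set L := (fun a b : color P => _) => freeL.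
move=> /palR_C3_freeP freeR.
(* Reversing the pairs [bc] turns out-degrees into in-degrees, so one bound serves both digraphs. *)
pose R (c b : color P) := [exists x, (x, b, c) \in admissible P].
have {}freeR : C3_free R by move=> a b c Rab Rbc Rca; apply: (freeR a c b).
have le_cherries : #|admissible P| <= \sum_b indeg L b * indeg R b.
  rewrite -card_cherries; apply: subset_leq_card; apply/subsetP => -[[a b] c] Pabc.
  by rewrite inE /=; apply/andP; split; apply/existsP; [exists c | exists a].
have AGM : 2 * (\sum_b indeg L b * indeg R b)
    <= \sum_b indeg L b ^ 2 + \sum_b indeg R b ^ 2.
  rewrite big_distrr -big_split /=.
  by apply: leq_sum => b _; apply: nat_Cauchy.
have := sum_sqr_indeg_le freeL; have := sum_sqr_indeg_le freeR.
lia.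
Qed.

(** * The extremal palette *)

Definition block_rel (m : nat) : rel 'I_m := fun a b => (a != b) && (b./2 <= a./2).

(** Both [L] and the reversed [R] equal [block_rel], so the in-degrees at the middle color agree and
    AM-GM is tight. *)
Definition block_palette (m : nat) : palette :=
  @Palette 'I_m
    [set p : 'I_m * 'I_m * 'I_m | block_rel p.1.1 p.1.2 && block_rel p.2 p.1.2].

(** The block index never increases along an arc, so a closed 3-walk would put three distinct
    vertices in one block of size at most 2. *)
Lemma block_rel_C3_free m : C3_free (@block_rel m).
Proof.
move=> a b c /andP[neq_ab le_ab] /andP[neq_bc le_bc] /andP[neq_ca le_ca].
move: neq_ab neq_bc neq_ca; rewrite -!val_eqE /=; lia.
Qed.

Lemma block_palette_avoids m : avoids C3 (block_palette m).
Proof.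
apply/andP; split.
  apply/palL_C3_freeP => a b c /existsP[x] + /existsP[y] + /existsP[z].
  rewrite !inE /= => /andP[ab _] /andP[bc _] /andP[ca _].
  exact: block_rel_C3_free ab bc ca.
apply/palR_C3_freeP => a b c /existsP[x] + /existsP[y] + /existsP[z].
rewrite !inE /= => /andP[_ ba] /andP[_ cb] /andP[_ ac].
exact: block_rel_C3_free ac cb ba.
Qed.

(** The in-neighbours of [b] are all vertices from the start [b./2.*2] of its block onward, except
    [b]. *)
Lemma indeg_block_rel m (b : 'I_m) : indeg (@block_rel m) b = m.-1 - b./2.*2.
Proof.
have b_lt := ltn_ord b.
have : \sum_(a < m) (b./2 <= a./2) = m - b./2.*2.
  rewrite -(big_mkord xpredT (fun a => nat_of_bool (b./2 <= a./2))).
  rewrite (@big_cat_nat _ _ _ b./2.*2) //=; last by lia.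
  rewrite big_nat_cond big1 => [|a /andP[/andP[_ lt_ab] _]]; last first.
    by apply/eqP; rewrite eqb0; lia.
  rewrite big_nat_cond (eq_bigr (fun=> 1)) => [|a /andP[/andP[le_ba _] _]].
    by rewrite -big_nat_cond sum_nat_const_nat; lia.
  by apply/eqP; rewrite eqb1; lia.
rewrite /indeg (bigD1 b) //= [X in _ -> X = _](bigD1 b) //= leqnn.
rewrite [block_rel b b]/block_rel eqxx /=.
rewrite [X in _ -> _ + X = _](eq_bigr (fun a : 'I_m => nat_of_bool (b./2 <= a./2))).
  by move: (\sum_(i < m | _) _) => x; lia.
by move=> a neq_ab; rewrite /block_rel neq_ab.
Qed.

(** Removing the first block, with its two equal squares, leaves the same sum for [m - 2]; hence an
    induction in steps of two. *)
Lemma sum_block_indeg m : 3 * (\sum_(b < m) (m.-1 - b./2.*2) ^ 2) + m = m ^ 3.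
Proof.
have [n le_mn] := ubnP m; elim: n => // n IHn in m le_mn *.
case: m le_mn => [|[|m]] le_mn; first by rewrite big_ord0.
  by rewrite big_ord_recl big_ord0.
rewrite !big_ord_recl /= !subn0.
rewrite (eq_bigr (fun b : 'I_m => (m.-1 - b./2.*2) ^ 2)); last first.
  by move=> b _; rewrite /bump /=; congr (_ ^ 2); lia.
have : m < n by lia.
by move/IHn; move: (\sum_(b < m) _) => x; lia.
Qed.

Lemma card_block_palette m : 3 * #|admissible (block_palette m)| + m = m ^ 3.
Proof.
rewrite card_cherries -[RHS]sum_block_indeg; congr (3 * _ + _).
by apply: eq_bigr => b _; rewrite indeg_block_rel mulnn.
Qed.

Lemma pal_C3 m : 3 * pal C3 m + m = m ^ 3.
Proof.
apply/eqP; rewrite eqn_leq; apply/andP; split.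
  rewrite /pal; elim/big_ind: _ => [|x y le_x le_y|A /andP[noL noR]].
  (* The default value 0 of the maximum must also obey the bound, that is [m <= m^3]. *)
  - by rewrite muln0 add0n; case: m => // m; rewrite -[leqLHS]expn1 leq_pexp2l.
  - by rewrite /maxn; case: ifP.
  - by have := card_admissible_le noL noR; rewrite /= card_ord.
rewrite -(card_block_palette m) leq_add2r leq_mul2l /=.
exact: (leq_bigmax_cond (admissible (block_palette m)) (block_palette_avoids m)).
Qed.

(** * From natural numbers to rational densities *)

Import Order.TTheory GRing.Theory Num.Theory.
Local Open Scope ring_scope.

(** Clearing denominators leads back to the subtraction-free form of the counting results; the pair
    lets one rewrite serve the bound and its attainment. *)
Lemma density_bound_natE (x m : nat) : (1 <= m)%N ->
  ((x%:R / m%:R ^+ 3 <= 1 / 3%:R - 1 / (3%:R * m%:R ^+ 2) :> rat)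
     = (3 * x + m <= m ^ 3)%N) *
  ((x%:R / m%:R ^+ 3 == 1 / 3%:R - 1 / (3%:R * m%:R ^+ 2) :> rat)
     = (3 * x + m == m ^ 3)%N).
Proof.
move=> m_gt0; have m0 : (m%:R : rat) != 0 by rewrite pnatr_eq0 -lt0n.
have -> : 1 / 3%:R - 1 / (3%:R * m%:R ^+ 2)
    = ((m%:R ^+ 3 - m%:R) / 3%:R) / m%:R ^+ 3 :> rat by field.
have m3 : (0 : rat) < m%:R ^+ 3 by rewrite exprn_gt0 // ltr0n.
have n3 : 3%:R != 0 :> rat by [].
have numE : (3 * x + m)%:R = 3%:R * x%:R + m%:R :> rat by rewrite natrD natrM.
split; last first.
  have m3V : (m%:R ^+ 3)^-1 != 0 :> rat by rewrite invr_eq0 gt_eqF.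
  rewrite (inj_eq (mulIf m3V)) -(inj_eq (mulIf n3)) divfK //.
  by rewrite eq_sym subr_eq eq_sym mulrC -numE -natrX eqr_nat.
rewrite ler_pM2r ?invr_gt0 // ler_pdivlMr ?ltr0n // lerBrDr mulrC -numE.
by rewrite -natrX ler_nat.
Qed.

Theorem corollary6p3 (m : nat) (hm : (1 <= m)%N) :
  ((pal C3 m)%:R = m%:R * (m%:R ^+ 2 - 1) / 3%:R :> rat)%R /\
  (forall P : palette, #|color P| = m ->
     ~~ hom_to (palL C3) P -> ~~ hom_to (palR C3) P ->
     (density P <= 1 / 3%:R - 1 / (3%:R * m%:R ^+ 2))%R) /\
  (exists P : palette,
     [/\ #|color P| = m, ~~ hom_to (palL C3) P, ~~ hom_to (palR C3) P &
         (density P = 1 / 3%:R - 1 / (3%:R * m%:R ^+ 2))%R]).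
Proof.
split.
  have /(congr1 (fun n => n%:R : rat)) := pal_C3 m.
  by rewrite natrD natrM natrX => h; lra.
split=> [P cardP noL noR|].
  by rewrite /density cardP density_bound_natE // -cardP card_admissible_le.
have /andP[noL noR] := block_palette_avoids m.
exists (block_palette m); split => //=; first exact: card_ord.
apply/eqP; rewrite /density card_ord density_bound_natE //.
by rewrite card_block_palette.
Qed.
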